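(* Let $G$ be a $2$-connected $[5,3]$-graph of order at least $9$ with minimum degree at least $3$. Then $G$ is pancyclic.
   Context: All graphs are finite and simple. The order of a graph is its number of vertices and the size is its number of edges. For integers $s$ and $t$, a graph $G$ is called an $[s,t]$-graph if every induced subgraph of $G$ of order $s$ has size at least $t$; thus $G$ is a $[5,3]$-graph if every set of $5$ vertices of $G$ induces a subgraph with at least $3$ edges. A graph of order $n$ is pancyclic if it contains a cycle of length $k$ (as a not necessarily induced subgraph) for every integer $k$ with $3\le k\le n$. *)

(* Defs.v *)
From mathcomp Require Import all_boot.

Set Implicit Arguments.
Unset Strict Implicit.
Unset Printing Implicit Defensive.

(* A finite simple graph is a symmetric irreflexive relation e on T : finType. *)

Section Graphs.

Variables (T : finType) (e : rel T).

Definition edges : {set {set T}} :=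
  [set E : {set T} | [exists x, exists y, e x y && (E == [set x; y])]].

Definition induced_size (S : {set T}) : nat :=
  #|[set E in edges | E \subset S]|.

Definition st_graph (s t : nat) : Prop :=
  forall S : {set T}, #|S| = s -> t <= induced_size S.

Definition degree (x : T) : nat := #|[set y | e x y]|.

Definition induced_rel (S : {set T}) : rel T :=
  [rel x y | [&& x \in S, y \in S & e x y]].

Definition induced_connected (S : {set T}) : Prop :=
  {in S &, forall x y, connect (induced_rel S) x y}.

Definition k_connected (k : nat) : Prop :=
  k < #|T| /\ (forall X : {set T}, #|X| < k -> induced_connected (~: X)).

(* For k < 3 a ucycle of size k is not a cycle of a simple graph (an edge gives
   one of size 2), so this is only meaningful for 3 <= k. *)
Definition has_cycle (k : nat) : Prop :=
  exists2 c : seq T, size c = k & ucycle e c.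

Definition pancyclic : Prop :=
  forall k, 3 <= k <= #|T| -> has_cycle k.

End Graphs.

(* Main.v *)
Require Import Defs.
From mathcomp Require Import all_boot.

(* Hamiltonicity: let [c] be a longest cycle and [v] a vertex off [c]. If two
   vertices [x], [y] of [c] are attached to the same component outside [c],
   then their successors on [c] are not adjacent, and a successor of an
   attached vertex is not attached. If that component has an edge [vw], the
   five vertices [v], [w], [x+], [y+], [p] force [y+] to be adjacent to [p =
   x++], and rerouting through the component skips only [x+] while inserting
   at least two vertices. Otherwise [v] has three neighbours [x], [y], [z]
   on [c], and [{v, x+, y+, z+}] is independent, hence every other vertex
   has at least three neighbours in it; as [c] has length at least 7, some
   [x+] is not a predecessor of [x], [y] or [z], so [x] can be bypassed and
   reinserted next to [v].

   Pancyclicity: in a [5,3]-graph any path on nine vertices can be shortened by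
   exactly one vertex keeping its ends, which takes a cycle of length [k >=
   9] to one of length [k - 1]. The lengths 3 to 7 occur inside any 9-cycle.
   Both facts concern graphs on nine vertices only and are checked on
   decision trees. *)

Set Implicit Arguments.
Unset Strict Implicit.
Unset Printing Implicit Defensive.

Fixpoint edge_count (A : Type) (r : rel A) (s : seq A) : nat :=
  if s is x :: s' then count (r x) s' + edge_count r s' else 0.

Lemma edge_count_map (A B : Type) (f : A -> B) (r : rel B) (s : seq A) :
  edge_count r (map f s) = edge_count (relpre f r) s.
Proof. by elim: s => //= x s ->; rewrite count_map. Qed.

(** Each pair of positions contributes to at most one of the two counts. On a list of five entries
    the right-hand side is 10, so eight known non-edges leave no room for three edges. *)
Lemma edge_count_disjoint (A : Type) (r1 r2 : rel A) (s : seq A) :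
    (forall x y, r1 x y -> ~~ r2 x y) ->
  edge_count r1 s + edge_count r2 s <= edge_count (fun _ _ => true) s.
Proof.
move=> r12; elim: s => //= x s IHs; rewrite addnACA leq_add // count_predT.
elim: {IHs} s => //= y s IHs; rewrite addnACA -add1n leq_add //.
by case: (boolP (r1 x y)) => [/r12/negPf->|_] //; case: (r2 x y).
Qed.

(** * Nine-vertex refutations *)

(* A decision tree over the edges of a graph on [0 .. 8]: [Split i j t1 t2]
   branches on whether [i] and [j] are joined; a leaf exhibits either a target
   path or cycle among the known edges, or five vertices spanning at least eight
   known non-edges. *)
Inductive refutation :=
  | Split of nat & nat & refutation & refutation
  | Target of seq nat
  | Sparse of seq nat.

Definition joined (E : seq (nat * nat)) : rel nat :=
  fun i j => ((i, j) \in E) || ((j, i) \in E).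

Fixpoint refutes (target : rel nat -> seq nat -> bool)
    (E N : seq (nat * nat)) (t : refutation) : bool :=
  match t with
  | Split i j t1 t2 =>
      refutes target ((i, j) :: E) N t1 && refutes target E ((i, j) :: N) t2
  | Target s => target (joined E) s
  | Sparse s =>
      [&& size s == 5, uniq s, all (gtn 9) s & 7 < edge_count (joined N) s]
  end.

Definition hits_cycle (k : nat) (r : rel nat) (s : seq nat) : bool :=
  [&& size s == k, uniq s, all (gtn 9) s & cycle r s].

(** The labels 0 to 8 follow a path on nine vertices. Eight distinct labels from 0 to 8 at the ends
    omit exactly one inner vertex. The default 9 is not a label. *)
Definition hits_path (r : rel nat) (s : seq nat) : bool :=
  [&& size s == 8, uniq s, all (gtn 9) s, head 9 s == 0, last 9 s == 8
    & path r 0 (behead s)].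

Definition path_edges : seq (nat * nat) := [seq (i, i.+1) | i <- iota 0 8].

Lemma joined_sub (r : rel nat) (E : seq (nat * nat)) : symmetric r ->
  {in E, forall p, r p.1 p.2} -> subrel (joined E) r.
Proof. by move=> r_sym Er i j /orP[/Er|/Er] //=; rewrite r_sym. Qed.

Lemma hits_cycle_mono k (r1 r2 : rel nat) s :
  subrel r1 r2 -> hits_cycle k r1 s -> hits_cycle k r2 s.
Proof.
move=> r12 /and4P[sk U s9 cs]; apply/and4P; split=> //.
exact: sub_cycle cs.
Qed.

Lemma hits_path_mono (r1 r2 : rel nat) s :
  subrel r1 r2 -> hits_path r1 s -> hits_path r2 s.
Proof. by rewrite /hits_path =>
  r12 /and5P[-> -> -> -> /andP[-> /(sub_path r12)]]. Qed.

(** Descend along the branches that tell the truth about [r], so that [E] and [N] stay correct. A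
    [Target] leaf passes to [r] by monotonicity; a [Sparse] leaf contradicts the bound of three
    edges on five vertices. *)
Lemma refutes_sound (target : rel nat -> seq nat -> bool) (r : rel nat) :
    symmetric r ->
    (forall r1 s, subrel r1 r -> target r1 s -> target r s) ->
    (forall s, size s = 5 -> uniq s -> all (gtn 9) s -> 2 < edge_count r s) ->
  forall t E N, {in E, forall p, r p.1 p.2} -> {in N, forall p, ~~ r p.1 p.2} ->
  refutes target E N t -> exists s, target r s.
Proof.
move=> r_sym mono r_53; elim=> [i j t1 IH1 t2 IH2|s|s] E N rE rN /=.
- case/andP=> H1 H2; have [rij|rij] := boolP (r i j).
    by apply: IH1 H1 => // p; rewrite inE => /predU1P[->|/rE].
  by apply: IH2 H2 => // p; rewrite inE => /predU1P[->|/rN].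
- by move=> Es; exists s; apply: mono Es; apply: joined_sub.
case/and4P=> /eqP s5 U s9 N8.
have NR i j : joined N i j -> ~~ r i j.
  (* The complement of [r] is symmetric too, so known non-edges are handled like known edges. *)
  apply: (joined_sub (r := fun i j => ~~ r i j)) => // ? ?.
  by rewrite r_sym.
(* 8 + 3 exceeds the 10 pairs of a five-element list; exposing the five entries lets that total
   compute. *)
have := leq_trans (leq_add N8 (r_53 s s5 U s9)) (edge_count_disjoint s NR).
by case: s s5 {U s9 N8} => [|? [|? [|? [|? [|? []]]]]].
Qed.

(** * Certificates for cycles of lengths 3 to 7 and for shortening a path *)

Definition cycle3_refutation : refutation :=
Split 0 2 (Target [:: 0; 1; 2]) (Split 1 8 (Target [:: 0; 1; 8]) (Split 0 7
(Target [:: 0; 7; 8]) (Split 1 3 (Target [:: 1; 2; 3]) (Split 2 4 (Target [::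
2; 3; 4]) (Split 3 5 (Target [:: 3; 4; 5]) (Split 4 6 (Target [:: 4; 5; 6])
(Split 5 7 (Target [:: 5; 6; 7]) (Split 6 8 (Target [:: 6; 7; 8]) (Split 0 4
(Split 1 4 (Target [:: 0; 1; 4]) (Split 0 3 (Target [:: 0; 3; 4]) (Split 0 5
(Target [:: 0; 4; 5]) (Split 4 8 (Target [:: 0; 4; 8]) (Split 1 5 (Split 1 6
(Target [:: 1; 5; 6]) (Split 2 6 (Split 3 6 (Target [:: 2; 3; 6]) (Sparse [::
1; 3; 4; 6; 8])) (Sparse [:: 1; 2; 4; 6; 8]))) (Split 1 7 (Split 3 7 (Split 1
6 (Target [:: 1; 6; 7]) (Split 3 6 (Target [:: 3; 6; 7]) (Split 3 8 (Target
[:: 3; 7; 8]) (Sparse [:: 1; 3; 4; 6; 8])))) (Sparse [:: 0; 1; 3; 5; 7]))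
(Sparse [:: 0; 1; 3; 5; 7]))))))) (Split 1 5 (Split 0 5 (Target [:: 0; 1; 5])
(Split 2 5 (Target [:: 1; 2; 5]) (Split 2 7 (Split 4 7 (Split 2 6 (Target [::
2; 6; 7]) (Split 2 8 (Target [:: 2; 7; 8]) (Split 4 8 (Target [:: 4; 7; 8])
(Sparse [:: 0; 2; 4; 6; 8])))) (Sparse [:: 0; 2; 4; 5; 7])) (Sparse [:: 0; 2;
4; 5; 7])))) (Split 1 6 (Split 0 6 (Target [:: 0; 1; 6]) (Split 2 6 (Target
[:: 1; 2; 6]) (Split 2 7 (Split 2 8 (Target [:: 2; 7; 8]) (Sparse [:: 0; 2; 4;
6; 8])) (Sparse [:: 0; 2; 4; 6; 7])))) (Split 3 8 (Split 0 3 (Target [:: 0; 3;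
8]) (Split 2 8 (Target [:: 2; 3; 8]) (Split 4 8 (Target [:: 3; 4; 8]) (Split 3
7 (Target [:: 3; 7; 8]) (Split 0 5 (Split 0 6 (Target [:: 0; 5; 6]) (Sparse
[:: 0; 2; 4; 6; 8])) (Sparse [:: 0; 1; 3; 5; 7])))))) (Split 3 6 (Split 5 8
(Split 0 5 (Target [:: 0; 5; 8]) (Split 2 6 (Target [:: 2; 3; 6]) (Split 3 7
(Target [:: 3; 6; 7]) (Split 4 8 (Target [:: 4; 5; 8]) (Split 0 3 (Split 0 6
(Target [:: 0; 3; 6]) (Sparse [:: 0; 2; 4; 6; 8])) (Sparse [:: 0; 1; 3; 5;
7])))))) (Sparse [:: 1; 3; 5; 6; 8])) (Sparse [:: 1; 3; 5; 6; 8])))))))))))))).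

Lemma refutes_no_cycle3 :
  refutes (hits_cycle 3) ((8, 0) :: path_edges) [::] cycle3_refutation.
Proof. by vm_compute. Qed.

Definition cycle4_refutation : refutation :=
Split 0 3 (Target [:: 0; 1; 2; 3]) (Split 2 8 (Target [:: 0; 1; 2; 8]) (Split
1 7 (Target [:: 0; 1; 7; 8]) (Split 0 6 (Target [:: 0; 6; 7; 8]) (Split 1 4
(Target [:: 1; 2; 3; 4]) (Split 2 5 (Target [:: 2; 3; 4; 5]) (Split 3 6
(Target [:: 3; 4; 5; 6]) (Split 4 7 (Target [:: 4; 5; 6; 7]) (Split 5 8
(Target [:: 5; 6; 7; 8]) (Split 0 2 (Split 1 3 (Target [:: 0; 1; 3; 2]) (Split
1 8 (Target [:: 0; 2; 1; 8]) (Split 0 4 (Target [:: 0; 2; 3; 4]) (Split 3 8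
(Target [:: 0; 2; 3; 8]) (Split 0 7 (Split 1 6 (Target [:: 0; 1; 6; 7]) (Split
6 8 (Target [:: 0; 7; 6; 8]) (Sparse [:: 0; 1; 3; 6; 8]))) (Split 3 7 (Split 4
6 (Target [:: 3; 4; 6; 7]) (Split 4 8 (Target [:: 3; 4; 8; 7]) (Split 1 6
(Split 6 8 (Target [:: 0; 1; 6; 8]) (Sparse [:: 0; 3; 4; 6; 8])) (Sparse [::
0; 1; 3; 4; 6])))) (Sparse [:: 0; 1; 3; 4; 7]))))))) (Split 0 7 (Split 1 6
(Target [:: 0; 1; 6; 7]) (Split 0 5 (Target [:: 0; 5; 6; 7]) (Split 6 8
(Target [:: 0; 7; 6; 8]) (Split 2 6 (Split 1 5 (Target [:: 1; 2; 6; 5]) (Split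
3 5 (Target [:: 2; 3; 5; 6]) (Split 1 3 (Split 3 8 (Target [:: 0; 1; 3; 8])
(Sparse [:: 0; 2; 3; 5; 8])) (Sparse [:: 0; 1; 3; 5; 6])))) (Sparse [:: 0; 2;
5; 6; 8]))))) (Split 1 3 (Split 0 4 (Target [:: 0; 1; 3; 4]) (Split 2 4
(Target [:: 1; 2; 4; 3]) (Split 1 5 (Target [:: 1; 3; 4; 5]) (Split 2 7 (Split
1 6 (Target [:: 1; 2; 7; 6]) (Split 1 8 (Target [:: 1; 2; 7; 8]) (Split 4 6
(Split 4 8 (Target [:: 4; 6; 7; 8]) (Sparse [:: 1; 2; 4; 5; 8])) (Sparse [::
0; 1; 4; 6; 7])))) (Sparse [:: 0; 1; 2; 4; 7]))))) (Split 1 6 (Split 0 5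
(Target [:: 0; 1; 6; 5]) (Split 6 8 (Target [:: 0; 1; 6; 8]) (Split 2 6 (Split
1 5 (Target [:: 1; 2; 6; 5]) (Split 3 5 (Target [:: 2; 3; 5; 6]) (Split 3 7
(Target [:: 2; 3; 7; 6]) (Sparse [:: 0; 1; 3; 5; 7])))) (Sparse [:: 0; 2; 5;
6; 8])))) (Split 3 7 (Split 2 6 (Target [:: 2; 3; 7; 6]) (Split 4 6 (Target
[:: 3; 4; 6; 7]) (Split 3 5 (Target [:: 3; 5; 6; 7]) (Split 0 4 (Split 0 5
(Split 3 8 (Target [:: 0; 4; 3; 8]) (Split 6 8 (Target [:: 0; 5; 6; 8])
(Sparse [:: 0; 2; 3; 6; 8]))) (Sparse [:: 0; 2; 3; 5; 6])) (Sparse [:: 0; 1;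
3; 4; 6]))))) (Sparse [:: 0; 1; 3; 6; 7])))))))))))))).

Lemma refutes_no_cycle4 :
  refutes (hits_cycle 4) ((8, 0) :: path_edges) [::] cycle4_refutation.
Proof. by vm_compute. Qed.

Definition cycle5_refutation : refutation :=
Split 0 4 (Target [:: 0; 1; 2; 3; 4]) (Split 3 8 (Target [:: 0; 1; 2; 3; 8])
(Split 2 7 (Target [:: 0; 1; 2; 7; 8]) (Split 1 6 (Target [:: 0; 1; 6; 7; 8])
(Split 0 5 (Target [:: 0; 5; 6; 7; 8]) (Split 1 5 (Target [:: 1; 2; 3; 4; 5])
(Split 2 6 (Target [:: 2; 3; 4; 5; 6]) (Split 3 7 (Target [:: 3; 4; 5; 6; 7])
(Split 4 8 (Target [:: 4; 5; 6; 7; 8]) (Split 0 3 (Split 2 4 (Target [:: 0; 1;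
2; 4; 3]) (Split 1 8 (Target [:: 0; 3; 2; 1; 8]) (Split 0 6 (Target [:: 0; 3;
4; 5; 6]) (Split 5 8 (Target [:: 0; 3; 4; 5; 8]) (Split 4 7 (Target [:: 0; 3;
4; 7; 8]) (Split 0 2 (Split 1 4 (Target [:: 0; 1; 4; 3; 2]) (Split 1 7 (Target
[:: 0; 2; 1; 7; 8]) (Split 2 5 (Target [:: 0; 2; 5; 4; 3]) (Split 2 8 (Split 1
3 (Target [:: 0; 1; 3; 2; 8]) (Sparse [:: 1; 3; 4; 7; 8])) (Sparse [:: 1; 2;
4; 5; 8]))))) (Split 0 7 (Split 4 6 (Target [:: 0; 3; 4; 6; 7]) (Sparse [:: 0;
2; 4; 6; 7])) (Sparse [:: 0; 2; 4; 6; 7])))))))) (Split 1 4 (Split 0 2 (Target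
[:: 0; 1; 4; 3; 2]) (Split 3 5 (Target [:: 1; 2; 3; 5; 4]) (Split 1 7 (Target
[:: 1; 4; 5; 6; 7]) (Split 0 7 (Split 5 7 (Target [:: 0; 1; 4; 5; 7]) (Split 1
3 (Split 2 5 (Target [:: 1; 2; 5; 4; 3]) (Sparse [:: 0; 2; 3; 5; 7])) (Sparse
[:: 0; 1; 3; 5; 7]))) (Split 1 3 (Split 2 5 (Target [:: 1; 2; 5; 4; 3])
(Sparse [:: 0; 2; 3; 5; 7])) (Sparse [:: 0; 1; 3; 5; 7])))))) (Split 2 5
(Split 0 6 (Target [:: 0; 1; 2; 5; 6]) (Split 1 3 (Target [:: 1; 2; 5; 4; 3])
(Split 1 7 (Target [:: 1; 2; 5; 6; 7]) (Split 4 6 (Target [:: 2; 3; 4; 6; 5])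
(Split 3 6 (Split 2 4 (Target [:: 2; 3; 6; 5; 4]) (Split 5 7 (Target [:: 3; 4;
5; 7; 6]) (Split 3 5 (Split 4 7 (Target [:: 3; 4; 7; 6; 5]) (Sparse [:: 1; 2;
4; 6; 7])) (Sparse [:: 0; 1; 3; 5; 7])))) (Sparse [:: 0; 1; 3; 4; 6]))))))
(Split 2 8 (Split 1 3 (Target [:: 0; 1; 3; 2; 8]) (Split 0 7 (Target [:: 0; 1;
2; 8; 7]) (Split 4 7 (Target [:: 2; 3; 4; 7; 8]) (Split 3 6 (Target [:: 2; 3;
6; 7; 8]) (Split 1 7 (Split 0 2 (Target [:: 0; 2; 1; 7; 8]) (Split 6 8 (Target
[:: 0; 1; 7; 6; 8]) (Split 0 6 (Split 1 8 (Target [:: 0; 1; 8; 7; 6]) (Sparse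
[:: 1; 3; 4; 6; 8])) (Sparse [:: 0; 2; 3; 6; 7])))) (Sparse [:: 0; 1; 3; 4;
7])))))) (Split 1 7 (Split 0 2 (Target [:: 0; 2; 1; 7; 8]) (Split 6 8 (Target
[:: 0; 1; 7; 6; 8]) (Split 3 6 (Target [:: 1; 2; 3; 6; 7]) (Split 0 6 (Split 1
8 (Target [:: 0; 1; 8; 7; 6]) (Split 5 7 (Target [:: 0; 6; 5; 7; 8]) (Split 0
7 (Split 5 8 (Target [:: 0; 7; 6; 5; 8]) (Sparse [:: 1; 2; 5; 6; 8])) (Sparse
[:: 0; 2; 3; 5; 7])))) (Sparse [:: 0; 2; 3; 6; 8]))))) (Split 0 6 (Split 1 8
(Target [:: 0; 1; 8; 7; 6]) (Split 5 7 (Target [:: 0; 6; 5; 7; 8]) (Split 5 8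
(Split 0 7 (Target [:: 0; 7; 6; 5; 8]) (Split 3 5 (Split 4 7 (Target [:: 3; 4;
7; 6; 5]) (Sparse [:: 0; 1; 4; 5; 7])) (Sparse [:: 0; 1; 3; 5; 7]))) (Sparse
[:: 1; 2; 5; 7; 8])))) (Split 3 6 (Split 2 4 (Target [:: 2; 3; 6; 5; 4])
(Split 5 7 (Target [:: 3; 4; 5; 7; 6]) (Split 4 7 (Split 3 5 (Target [:: 3; 4;
7; 6; 5]) (Split 0 7 (Split 5 8 (Target [:: 0; 7; 6; 5; 8]) (Sparse [:: 2; 3;
5; 7; 8])) (Sparse [:: 0; 1; 3; 5; 7]))) (Sparse [:: 1; 2; 4; 5; 7])))) (Split
0 7 (Split 5 8 (Target [:: 0; 7; 6; 5; 8]) (Split 0 2 (Split 1 8 (Target [::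
0; 2; 1; 8; 7]) (Split 4 7 (Target [:: 0; 2; 3; 4; 7]) (Split 2 4 (Split 1 3
(Target [:: 0; 1; 3; 4; 2]) (Sparse [:: 1; 3; 4; 7; 8])) (Sparse [:: 1; 2; 4;
5; 8])))) (Split 3 5 (Split 2 4 (Split 1 3 (Target [:: 1; 2; 4; 5; 3]) (Split
4 6 (Target [:: 2; 3; 5; 6; 4]) (Sparse [:: 0; 1; 3; 4; 6]))) (Sparse [:: 0;
2; 4; 5; 8])) (Sparse [:: 0; 2; 3; 5; 6])))) (Split 1 3 (Split 0 2 (Split 2 4
(Target [:: 0; 1; 3; 4; 2]) (Split 1 8 (Target [:: 0; 2; 3; 1; 8]) (Split 6 8
(Split 4 7 (Target [:: 4; 5; 6; 8; 7]) (Sparse [:: 1; 2; 4; 7; 8])) (Sparse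
[:: 1; 2; 4; 6; 8])))) (Sparse [:: 0; 2; 3; 6; 7])) (Sparse [:: 0; 1; 3; 6;
7])))))))))))))))))).

Lemma refutes_no_cycle5 :
  refutes (hits_cycle 5) ((8, 0) :: path_edges) [::] cycle5_refutation.
Proof. by vm_compute. Qed.

Definition cycle6_refutation : refutation :=
Split 0 5 (Target [:: 0; 1; 2; 3; 4; 5]) (Split 4 8 (Target [:: 0; 1; 2; 3; 4;
8]) (Split 3 7 (Target [:: 0; 1; 2; 3; 7; 8]) (Split 2 6 (Target [:: 0; 1; 2;
6; 7; 8]) (Split 1 5 (Target [:: 0; 1; 5; 6; 7; 8]) (Split 0 4 (Target [:: 0;
4; 5; 6; 7; 8]) (Split 1 6 (Target [:: 1; 2; 3; 4; 5; 6]) (Split 2 7 (Target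
[:: 2; 3; 4; 5; 6; 7]) (Split 3 8 (Target [:: 3; 4; 5; 6; 7; 8]) (Split 0 3
(Split 2 5 (Target [:: 0; 1; 2; 5; 4; 3]) (Split 1 7 (Target [:: 0; 3; 2; 1;
7; 8]) (Split 0 7 (Target [:: 0; 3; 4; 5; 6; 7]) (Split 6 8 (Target [:: 0; 3;
4; 5; 6; 8]) (Split 5 7 (Target [:: 0; 3; 4; 5; 7; 8]) (Split 3 5 (Target [::
0; 3; 5; 6; 7; 8]) (Split 1 3 (Split 5 8 (Target [:: 0; 1; 3; 4; 5; 8]) (Split
4 7 (Target [:: 0; 1; 3; 4; 7; 8]) (Split 3 6 (Target [:: 0; 1; 3; 6; 7; 8])
(Split 1 4 (Split 2 8 (Target [:: 0; 1; 4; 3; 2; 8]) (Sparse [:: 2; 3; 5; 6;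
8])) (Sparse [:: 0; 1; 4; 5; 7]))))) (Sparse [:: 0; 1; 3; 5; 7])))))))) (Split
0 6 (Split 4 6 (Target [:: 0; 1; 2; 3; 4; 6]) (Split 3 5 (Target [:: 0; 1; 2;
3; 5; 6]) (Split 2 4 (Target [:: 0; 1; 2; 4; 5; 6]) (Split 2 8 (Target [:: 0;
1; 2; 8; 7; 6]) (Split 0 2 (Target [:: 0; 2; 3; 4; 5; 6]) (Split 4 7 (Target
[:: 0; 6; 5; 4; 7; 8]) (Split 0 7 (Split 2 5 (Target [:: 0; 1; 2; 5; 6; 7])
(Split 1 4 (Target [:: 0; 1; 4; 5; 6; 7]) (Split 5 8 (Split 1 7 (Target [:: 0;
1; 7; 6; 5; 8]) (Sparse [:: 1; 2; 4; 6; 7])) (Sparse [:: 0; 2; 3; 5; 8]))))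
(Sparse [:: 0; 2; 3; 4; 7])))))))) (Split 1 4 (Split 6 8 (Target [:: 0; 1; 4;
5; 6; 8]) (Split 4 6 (Target [:: 0; 1; 4; 6; 7; 8]) (Split 3 6 (Target [:: 1;
2; 3; 6; 5; 4]) (Sparse [:: 0; 3; 4; 6; 8])))) (Split 1 7 (Split 5 7 (Target
[:: 1; 2; 3; 4; 5; 7]) (Split 4 6 (Target [:: 1; 2; 3; 4; 6; 7]) (Split 3 5
(Target [:: 1; 2; 3; 5; 6; 7]) (Split 1 3 (Target [:: 1; 3; 4; 5; 6; 7])
(Split 3 6 (Split 0 7 (Target [:: 0; 1; 2; 3; 6; 7]) (Sparse [:: 0; 1; 3; 5;
7])) (Sparse [:: 0; 1; 3; 4; 6])))))) (Split 2 5 (Split 0 7 (Target [:: 0; 1;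
2; 5; 6; 7]) (Split 5 7 (Target [:: 0; 1; 2; 5; 7; 8]) (Split 4 7 (Target [::
2; 3; 4; 7; 6; 5]) (Sparse [:: 0; 1; 4; 5; 7])))) (Split 2 8 (Split 5 7
(Target [:: 2; 3; 4; 5; 7; 8]) (Split 3 5 (Target [:: 2; 3; 5; 6; 7; 8])
(Split 2 4 (Target [:: 2; 4; 5; 6; 7; 8]) (Split 0 7 (Split 4 7 (Target [:: 0;
1; 2; 3; 4; 7]) (Sparse [:: 1; 2; 4; 5; 7])) (Sparse [:: 0; 1; 3; 5; 7])))))
(Split 3 6 (Split 6 8 (Target [:: 0; 1; 2; 3; 6; 8]) (Split 0 2 (Target [:: 0;
2; 3; 6; 7; 8]) (Split 5 8 (Target [:: 3; 4; 5; 8; 7; 6]) (Sparse [:: 0; 2; 5;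
6; 8])))) (Split 0 2 (Split 5 8 (Target [:: 0; 2; 3; 4; 5; 8]) (Split 4 7
(Target [:: 0; 2; 3; 4; 7; 8]) (Split 0 7 (Split 5 7 (Target [:: 0; 2; 3; 4;
5; 7]) (Split 2 4 (Target [:: 0; 2; 4; 5; 6; 7]) (Sparse [:: 1; 2; 4; 5; 7])))
(Split 1 3 (Split 5 7 (Split 4 6 (Split 6 8 (Target [:: 0; 1; 3; 4; 6; 8])
(Split 3 5 (Target [:: 0; 1; 3; 5; 7; 8]) (Sparse [:: 0; 3; 5; 6; 8])))
(Sparse [:: 0; 1; 4; 6; 7])) (Sparse [:: 0; 1; 4; 5; 7])) (Sparse [:: 0; 1; 3;
4; 7]))))) (Split 3 5 (Split 0 7 (Split 6 8 (Split 5 8 (Target [:: 0; 1; 2; 3;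
5; 8]) (Split 5 7 (Target [:: 0; 1; 2; 3; 5; 7]) (Split 1 8 (Target [:: 1; 2;
3; 5; 6; 8]) (Sparse [:: 1; 2; 5; 7; 8])))) (Sparse [:: 0; 2; 3; 6; 8]))
(Sparse [:: 0; 2; 3; 6; 7])) (Sparse [:: 0; 2; 3; 5; 6])))))))))))))))))).

Lemma refutes_no_cycle6 :
  refutes (hits_cycle 6) ((8, 0) :: path_edges) [::] cycle6_refutation.
Proof. by vm_compute. Qed.

Definition cycle7_refutation : refutation :=
Split 0 6 (Target [:: 0; 1; 2; 3; 4; 5; 6]) (Split 5 8 (Target [:: 0; 1; 2; 3;
4; 5; 8]) (Split 4 7 (Target [:: 0; 1; 2; 3; 4; 7; 8]) (Split 3 6 (Target [::
0; 1; 2; 3; 6; 7; 8]) (Split 2 5 (Target [:: 0; 1; 2; 5; 6; 7; 8]) (Split 1 4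
(Target [:: 0; 1; 4; 5; 6; 7; 8]) (Split 0 3 (Target [:: 0; 3; 4; 5; 6; 7; 8])
(Split 1 7 (Target [:: 1; 2; 3; 4; 5; 6; 7]) (Split 2 8 (Target [:: 2; 3; 4;
5; 6; 7; 8]) (Split 0 2 (Split 1 6 (Target [:: 0; 1; 6; 5; 4; 3; 2]) (Split 1
5 (Target [:: 0; 2; 1; 5; 6; 7; 8]) (Split 0 7 (Target [:: 0; 2; 3; 4; 5; 6;
7]) (Split 5 7 (Target [:: 0; 2; 3; 4; 5; 7; 8]) (Split 4 6 (Target [:: 0; 2;
3; 4; 6; 7; 8]) (Split 2 4 (Target [:: 0; 2; 4; 5; 6; 7; 8]) (Split 0 4 (Split
2 7 (Target [:: 0; 1; 2; 7; 6; 5; 4]) (Sparse [:: 1; 2; 4; 5; 7])) (Sparse [::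
0; 1; 4; 6; 7])))))))) (Split 0 4 (Split 2 7 (Target [:: 0; 1; 2; 7; 6; 5; 4])
(Split 2 6 (Target [:: 0; 4; 3; 2; 6; 7; 8]) (Split 3 5 (Target [:: 0; 4; 3;
5; 6; 7; 8]) (Split 0 5 (Split 3 7 (Target [:: 0; 1; 2; 3; 7; 6; 5]) (Split 3
8 (Target [:: 0; 4; 3; 8; 7; 6; 5]) (Split 0 7 (Split 5 7 (Target [:: 0; 1; 2;
3; 4; 5; 7]) (Sparse [:: 2; 3; 5; 7; 8])) (Sparse [:: 0; 2; 3; 6; 7]))))
(Sparse [:: 0; 2; 3; 5; 6]))))) (Split 0 5 (Split 4 6 (Target [:: 0; 1; 2; 3;
4; 6; 5]) (Split 3 7 (Target [:: 0; 1; 2; 3; 7; 6; 5]) (Split 0 7 (Split 2 4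
(Target [:: 0; 1; 2; 4; 5; 6; 7]) (Split 2 6 (Target [:: 0; 5; 4; 3; 2; 6; 7])
(Sparse [:: 0; 2; 3; 4; 6]))) (Sparse [:: 0; 3; 4; 6; 7])))) (Split 2 4 (Split
3 7 (Target [:: 0; 1; 2; 4; 3; 7; 8]) (Split 0 7 (Target [:: 0; 1; 2; 4; 5; 6;
7]) (Split 4 6 (Target [:: 0; 1; 2; 4; 6; 7; 8]) (Sparse [:: 0; 3; 4; 6;
7])))) (Split 4 8 (Split 3 5 (Target [:: 0; 1; 2; 3; 5; 4; 8]) (Split 2 6
(Target [:: 0; 1; 2; 6; 5; 4; 8]) (Sparse [:: 0; 2; 3; 5; 6]))) (Sparse [:: 0;
2; 4; 5; 8])))))))))))))).

Lemma refutes_no_cycle7 :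
  refutes (hits_cycle 7) ((8, 0) :: path_edges) [::] cycle7_refutation.
Proof. by vm_compute. Qed.

Definition path_refutation : refutation :=
Split 6 8 (Target [:: 0; 1; 2; 3; 4; 5; 6; 8]) (Split 5 7 (Target [:: 0; 1; 2;
3; 4; 5; 7; 8]) (Split 4 6 (Target [:: 0; 1; 2; 3; 4; 6; 7; 8]) (Split 3 5
(Target [:: 0; 1; 2; 3; 5; 6; 7; 8]) (Split 2 4 (Target [:: 0; 1; 2; 4; 5; 6;
7; 8]) (Split 1 3 (Target [:: 0; 1; 3; 4; 5; 6; 7; 8]) (Split 0 2 (Target [::
0; 2; 3; 4; 5; 6; 7; 8]) (Split 2 6 (Split 3 8 (Target [:: 0; 1; 2; 6; 5; 4;
3; 8]) (Split 1 4 (Target [:: 0; 1; 4; 3; 2; 6; 7; 8]) (Split 4 7 (Target [::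
0; 1; 2; 6; 5; 4; 7; 8]) (Split 0 5 (Target [:: 0; 5; 4; 3; 2; 6; 7; 8])
(Split 0 3 (Split 1 5 (Target [:: 0; 3; 2; 1; 5; 6; 7; 8]) (Split 2 5 (Target
[:: 0; 3; 4; 5; 2; 6; 7; 8]) (Split 2 7 (Target [:: 0; 3; 4; 5; 6; 2; 7; 8])
(Split 0 4 (Split 1 7 (Target [:: 0; 4; 5; 6; 2; 1; 7; 8]) (Sparse [:: 1; 2;
4; 5; 7])) (Sparse [:: 0; 2; 4; 5; 7]))))) (Split 0 4 (Split 1 5 (Target [::
0; 4; 5; 1; 2; 6; 7; 8]) (Split 1 7 (Target [:: 0; 4; 5; 6; 2; 1; 7; 8])
(Split 3 7 (Target [:: 0; 4; 5; 6; 2; 3; 7; 8]) (Sparse [:: 0; 1; 3; 5; 7]))))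
(Split 0 7 (Split 2 8 (Target [:: 0; 7; 6; 5; 4; 3; 2; 8]) (Split 5 8 (Target
[:: 0; 7; 6; 2; 3; 4; 5; 8]) (Split 2 5 (Split 4 8 (Target [:: 0; 7; 6; 5; 2;
3; 4; 8]) (Split 0 6 (Split 1 8 (Target [:: 0; 6; 5; 4; 3; 2; 1; 8]) (Split 1
5 (Split 3 6 (Target [:: 0; 1; 5; 4; 3; 6; 7; 8]) (Sparse [:: 1; 3; 4; 6; 8]))
(Sparse [:: 0; 1; 3; 5; 8]))) (Sparse [:: 0; 2; 4; 6; 8]))) (Sparse [:: 0; 2;
3; 5; 8])))) (Split 2 5 (Split 3 7 (Target [:: 0; 1; 2; 5; 4; 3; 7; 8])
(Sparse [:: 0; 3; 4; 5; 7])) (Sparse [:: 0; 2; 4; 5; 7]))))))))) (Split 1 6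
(Split 2 8 (Target [:: 0; 1; 6; 5; 4; 3; 2; 8]) (Split 0 4 (Target [:: 0; 4;
3; 2; 1; 6; 7; 8]) (Split 0 6 (Split 4 8 (Split 2 7 (Target [:: 0; 1; 2; 7; 6;
5; 4; 8]) (Split 2 5 (Target [:: 0; 1; 6; 5; 2; 3; 4; 8]) (Split 0 5 (Target
[:: 0; 5; 6; 1; 2; 3; 4; 8]) (Split 1 5 (Target [:: 0; 6; 5; 1; 2; 3; 4; 8])
(Split 1 7 (Target [:: 0; 6; 7; 1; 2; 3; 4; 8]) (Split 0 7 (Target [:: 0; 7;
6; 1; 2; 3; 4; 8]) (Sparse [:: 0; 1; 2; 5; 7]))))))) (Sparse [:: 0; 2; 4; 6;
8])) (Sparse [:: 0; 2; 4; 6; 8])))) (Split 2 7 (Split 1 5 (Target [:: 0; 1; 5;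
4; 3; 2; 7; 8]) (Split 4 8 (Target [:: 0; 1; 2; 7; 6; 5; 4; 8]) (Split 0 6
(Target [:: 0; 6; 5; 4; 3; 2; 7; 8]) (Split 0 4 (Split 2 8 (Split 0 7 (Target
[:: 0; 7; 6; 5; 4; 3; 2; 8]) (Split 1 7 (Target [:: 0; 4; 5; 6; 7; 1; 2; 8])
(Split 0 3 (Target [:: 0; 3; 4; 5; 6; 7; 2; 8]) (Split 3 7 (Target [:: 0; 4;
5; 6; 7; 3; 2; 8]) (Sparse [:: 0; 1; 3; 5; 7]))))) (Sparse [:: 0; 2; 4; 6;
8])) (Sparse [:: 0; 2; 4; 6; 8]))))) (Split 1 5 (Split 0 3 (Target [:: 0; 3;
2; 1; 5; 6; 7; 8]) (Split 3 6 (Target [:: 0; 1; 5; 4; 3; 6; 7; 8]) (Split 0 4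
(Split 2 5 (Target [:: 0; 4; 3; 2; 5; 6; 7; 8]) (Split 3 7 (Target [:: 0; 4;
5; 1; 2; 3; 7; 8]) (Split 0 7 (Split 2 8 (Target [:: 0; 7; 6; 5; 4; 3; 2; 8])
(Split 3 8 (Target [:: 0; 7; 6; 5; 1; 2; 3; 8]) (Split 0 6 (Split 1 8 (Target
[:: 0; 6; 5; 4; 3; 2; 1; 8]) (Sparse [:: 1; 2; 3; 6; 8])) (Sparse [:: 0; 2; 3;
6; 8])))) (Sparse [:: 0; 2; 3; 5; 7])))) (Split 0 6 (Split 1 8 (Target [:: 0;
6; 5; 4; 3; 2; 1; 8]) (Split 4 8 (Target [:: 0; 6; 5; 1; 2; 3; 4; 8]) (Split 1
4 (Split 3 8 (Target [:: 0; 6; 5; 4; 1; 2; 3; 8]) (Sparse [:: 1; 3; 4; 6; 8]))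
(Sparse [:: 1; 2; 4; 6; 8])))) (Sparse [:: 0; 2; 3; 4; 6]))))) (Split 1 7
(Split 0 5 (Target [:: 0; 5; 4; 3; 2; 1; 7; 8]) (Split 3 8 (Target [:: 0; 1;
7; 6; 5; 4; 3; 8]) (Split 1 8 (Split 0 6 (Target [:: 0; 6; 5; 4; 3; 2; 1; 8])
(Split 0 3 (Target [:: 0; 3; 4; 5; 6; 7; 1; 8]) (Split 3 6 (Split 4 8 (Target
[:: 0; 1; 2; 3; 6; 5; 4; 8]) (Split 0 4 (Target [:: 0; 4; 5; 6; 3; 2; 1; 8])
(Sparse [:: 0; 2; 4; 6; 8]))) (Sparse [:: 0; 1; 3; 5; 6])))) (Split 3 6 (Split
5 8 (Target [:: 0; 1; 7; 6; 3; 4; 5; 8]) (Sparse [:: 1; 3; 5; 6; 8])) (Sparse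
[:: 1; 3; 5; 6; 8]))))) (Split 2 5 (Split 3 7 (Target [:: 0; 1; 2; 5; 4; 3; 7;
8]) (Split 0 4 (Target [:: 0; 4; 3; 2; 5; 6; 7; 8]) (Split 3 6 (Split 4 8
(Target [:: 0; 1; 2; 3; 6; 5; 4; 8]) (Split 0 6 (Split 2 8 (Split 0 7 (Target
[:: 0; 7; 6; 5; 4; 3; 2; 8]) (Split 1 4 (Target [:: 0; 1; 4; 5; 6; 3; 2; 8])
(Split 4 7 (Target [:: 0; 6; 5; 2; 3; 4; 7; 8]) (Sparse [:: 0; 1; 2; 4; 7]))))
(Sparse [:: 0; 2; 4; 6; 8])) (Sparse [:: 0; 2; 4; 6; 8]))) (Sparse [:: 1; 3;
5; 6; 7])))) (Split 3 7 (Split 5 8 (Target [:: 0; 1; 2; 3; 7; 6; 5; 8]) (Split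
0 5 (Split 1 4 (Target [:: 0; 5; 4; 1; 2; 3; 7; 8]) (Split 1 8 (Target [:: 0;
5; 6; 7; 3; 2; 1; 8]) (Split 4 8 (Split 3 6 (Target [:: 0; 1; 2; 3; 6; 5; 4;
8]) (Sparse [:: 1; 3; 5; 6; 8])) (Sparse [:: 1; 2; 4; 6; 8])))) (Split 0 7
(Split 2 8 (Target [:: 0; 7; 6; 5; 4; 3; 2; 8]) (Split 0 6 (Split 1 8 (Target
[:: 0; 6; 5; 4; 3; 2; 1; 8]) (Sparse [:: 1; 2; 5; 6; 8])) (Sparse [:: 0; 2; 5;
6; 8]))) (Sparse [:: 0; 1; 2; 5; 7])))) (Sparse [:: 1; 2; 3; 5;
7])))))))))))))).

(** Unlike the trees for cycles, this one does not start with the closing edge [(8, 0)], so it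
    applies to nine consecutive vertices of any longer cycle. *)
Lemma refutes_no_path : refutes hits_path path_edges [::] path_refutation.
Proof. by vm_compute. Qed.

(** * Cycles shorter by one vertex *)

Section Graph.

Variables (T : finType) (e : rel T).
Hypotheses (e_sym : symmetric e) (e_irr : irreflexive e).

(** Induction on the list: an edge inside [x :: s] either joins [x] to one of its neighbours in [s]
    or lies inside [s]. *)
Lemma induced_size_le (s : seq T) :
  induced_size e [set x in s] <= edge_count e s.
Proof.
elim: s => [|x s IHs] /=.
  rewrite leqn0 cards_eq0; apply/eqP/setP=> E; rewrite !inE.
  apply/negP=> /andP[/existsP[y /existsP[z /andP[_ /eqP->]]]].
  by move=> /subsetP/(_ y); rewrite !inE eqxx => /(_ isT).
rewrite -size_filter; apply: leq_trans (leq_add (leqnn _) IHs).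
set S := map (fun y => [set x; y]) (filter (e x) s).
have <- : size S = size (filter (e x) s) by rewrite size_map.
set F := [set E in edges e | E \subset [set y in s]].
apply: leq_trans (_ : #|[set E in S] :|: F| <= _).
  apply/subset_leq_card/subsetP=> E; rewrite !inE => /andP[Ee /subsetP sE].
  rewrite Ee /=; case/existsP: Ee => y /existsP[z /andP[eyz /eqP defE]].
  have nyz : y != z by apply: contraTneq eyz => ->; rewrite e_irr.
  have := sE y; rewrite defE !inE eqxx => /(_ isT) /predU1P[yx|ys].
    have := sE z; rewrite defE !inE eqxx orbT => /(_ isT) /predU1P[zx|zs].
      by rewrite yx zx eqxx in nyz.
    by apply/orP; left; apply/mapP; exists z; rewrite ?mem_filter -yx ?eyz.
  have := sE z; rewrite defE !inE eqxx orbT => /(_ isT) /predU1P[zx|zs].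
    apply/orP; left; apply/mapP; exists y; last by rewrite zx setUC.
    by rewrite mem_filter ys -zx e_sym eyz.
  by apply/orP; right; apply/subsetP=> t; rewrite !inE => /orP[]/eqP->.
apply: leq_trans (leq_card_setU _ _) _; rewrite leq_add2r.
by rewrite cardsE; apply: card_size.
Qed.

Hypothesis e_53 : st_graph e 5 3.

Lemma st_graph_edge_count (s : seq T) :
  uniq s -> size s = 5 -> 3 <= edge_count e s.
Proof.
move=> Us s5; apply: leq_trans (induced_size_le s); apply: e_53.
by rewrite cardsE (card_uniqP Us).
Qed.

Section NineVertices.

Variables (x0 : T) (c : seq T).
Hypotheses (U : uniq (take 9 c)) (c9 : 9 <= size c).
Hypothesis pc : sorted e (take 9 c).

Let p i := nth x0 (take 9 c) i.

Let size_take9 : size (take 9 c) = 9.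
Proof. by rewrite size_take_min; apply/minn_idPl. Qed.

Lemma map_nine_uniq s : uniq s -> all (gtn 9) s -> uniq (map p s).
Proof.
move=> Us s9; rewrite map_inj_in_uniq // =>
  i j /(allP s9) i9 /(allP s9) j9 /eqP.
by rewrite nth_uniq ?size_take9 // => /eqP.
Qed.

(** The graph is pulled back to labels along [p]. This map is injective below 9 only, larger labels
    all going to [x0], but [Sparse] leaves use labels below 9. *)
Lemma nine_refuted target E t : refutes target E [::] t ->
    (forall r1 r2 s, subrel r1 r2 -> target r1 s -> target r2 s) ->
    {in E, forall q, e (p q.1) (p q.2)} ->
  exists s, target (relpre p e) s.
Proof.
move=> ref mono Ee; apply: (refutes_sound _ _ _ Ee _ ref) => //.
- by move=> i j; apply: e_sym.
- by move=> r1 s; apply: mono.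
move=> s s5 Us s9; rewrite -edge_count_map; apply: st_graph_edge_count.
  exact: map_nine_uniq.
by rewrite size_map.
Qed.

Lemma path_edgesP : {in path_edges, forall q, e (p q.1) (p q.2)}.
Proof.
move=> q /mapP[i]; rewrite mem_iota => /andP[_ i8] ->.
by have /(sortedP x0)/(_ i) := pc; rewrite size_take9; apply.
Qed.

End NineVertices.

Lemma nine_cycle_shorter (c : seq T) k :
  ucycle e c -> size c = 9 -> 2 < k < 8 -> has_cycle e k.
Proof.
case: c => // x0 s; set c := x0 :: s => /andP[C U] c9 k38.
have take_c : take 9 c = c by rewrite take_oversize ?c9.
have pc : sorted e (take 9 c).
  by rewrite take_c; move: C; rewrite /= rcons_path => /andP[].
pose p i := nth x0 (take 9 c) i.
have cycE : {in (8, 0) :: path_edges, forall q, e (p q.1) (p q.2)}.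
  move=> q; rewrite inE => /predU1P[->|]; last by apply: path_edgesP;
    rewrite ?c9.
  (* The pair [(8, 0)] is the edge that closes the cycle. *)
  move: C; rewrite /p take_c /= rcons_path -(nth_last x0) => /andP[_].
  by case: c9 => ->.
have [s' /and4P[/eqP sk Us' s9 cs]] : exists s', hits_cycle k (relpre p e) s'.
  have ref t : refutes (hits_cycle k) ((8, 0) :: path_edges) [::] t ->
      exists s', hits_cycle k (relpre p e) s'.
    move=> ref; apply: (nine_refuted _ _ ref _ cycE); rewrite ?take_c ?c9 //.
    by move=> r1 r2 s'; apply: hits_cycle_mono.
  move: k k38 ref => [|[|[|[|[|[|[|[|k]]]]]]]] // _.
  - by apply; apply: refutes_no_cycle3.
  - by apply; apply: refutes_no_cycle4.
  - by apply; apply: refutes_no_cycle5.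
  - by apply; apply: refutes_no_cycle6.
  - by apply; apply: refutes_no_cycle7.
exists (map p s'); first by rewrite size_map.
by rewrite /ucycle cycle_map cs map_nine_uniq ?take_c ?c9.
Qed.

(** The first nine vertices form a path. It is replaced by a path on eight of them with the same
    ends, and the rest of the cycle attaches as before. *)
Lemma cycle_pred (c : seq T) : ucycle e c -> 9 <= size c ->
  has_cycle e (size c).-1.
Proof.
move=> /andP[C U] c9.
case: c C U c9 => // x0 s0; set c := x0 :: s0 => C U c9.
have def_c : take 9 c ++ drop 9 c = c := cat_take_drop 9 c.
have Ut : uniq (take 9 c) by apply: subseq_uniq U; apply: take_subseq.
pose t := take 8 s0; have def_t : take 9 c = x0 :: t by [].
have t8 : size t = 8 by rewrite size_take_min; apply/minn_idPl.
have pt : path e x0 t.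
  by move: C; rewrite -def_c def_t /= rcons_cat cat_path => /andP[].
pose p i := nth x0 (take 9 c) i.
have [s] := nine_refuted (x0 := x0) Ut c9 refutes_no_path hits_path_mono
  (path_edgesP x0 c9 pt).
case/and5P=> /eqP s8 Us s9 s0E /andP[lasts ps].
case: s s0E => // _ s1 /eqP/= -> in s8 Us s9 lasts ps *.
have last_t : last x0 t = p 8 by rewrite /p def_t -t8 -(nth_last x0) t8.
exists (map p (0 :: s1) ++ drop 9 c).
  transitivity (8 + (size c - 9)); last exact: (congr1 predn (subnKC c9)).
  by rewrite size_cat size_drop size_map; congr (_ + _).
apply/andP; split.
  have lastp : last x0 (map p s1) = last x0 t.
    by rewrite -[x0 in LHS]/(p 0) last_map (eqP lasts).
  move: C; rewrite -{1}def_c def_t /= !rcons_cat !cat_path lastp => /andP[_ ->].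
  by rewrite andbT path_map.
rewrite cat_uniq map_nine_uniq // (subseq_uniq (drop_subseq _ _) U) andbT.
apply/hasPn=> z zd; apply/negP=> /mapP[i is1 def_z].
move: U; rewrite -def_c cat_uniq => /and3P[_ /hasPn/(_ z zd)/negP nz _];
  apply: nz.
have/allP/(_ i is1) i9 : all (gtn 9) (0 :: s1) by [].
by rewrite def_z mem_nth // def_t /= t8.
Qed.

Lemma hamiltonian_pancyclic (c : seq T) :
  9 <= #|T| -> ucycle e c -> size c = #|T| -> pancyclic e.
Proof.
move=> T9 Cc sc k /andP[k3 kT].
(* Vertices are removed one at a time from the spanning cycle. The descent ends at 8 because
   [cycle_pred] starts from at least nine vertices. *)
have down m : 8 <= m <= #|T| -> has_cycle e m.
  move=> /andP[m8 mT]; rewrite -(subKn mT).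
  have : #|T| - m <= #|T| - 8 by rewrite leq_sub2l.
  elim: (#|T| - m) => [|j IHj] jT; first by rewrite subn0; exists c.
  have [c' sc' Cc'] := IHj (ltnW jT).
  rewrite subnS -sc'; apply: cycle_pred; rewrite // sc'.
  by rewrite ltn_subRL addnC -ltn_subRL.
have [k8|k8] := leqP 8 k; first by apply: down; rewrite k8.
have [c9 sc9 Cc9] := down 9 T9.
by apply: nine_cycle_shorter Cc9 sc9 _; rewrite k3.
Qed.
(** * Longest cycles *)

Lemma path_rev_rcons (x y : T) (s : seq T) :
  path e y (rcons (rev s) x) = path e x (rcons s y).
Proof.
rewrite -rev_cons -[X in rev X](belast_rcons x s y).
rewrite -[X in path e X](last_rcons x s y) rev_path.
by apply: eq_path => u w; rewrite e_sym.
Qed.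

Hypothesis e_2conn : k_connected e 2.

(** A path from [a] to [b] survives the deletion of [z]; the first edge along which it leaves [A] is
    the one sought. *)
Lemma two_connected_boundary (A : {set T}) (z a b : T) :
    a \in A -> a != z -> b \notin A -> b != z ->
  exists a' b', [/\ a' \in A, b' \notin A, a' != z, b' != z & e a' b'].
Proof.
move=> aA az bA bz; have [_ /(_ [set z])] := e_2conn.
rewrite cards1 => /(_ isT a b);
  rewrite !inE => /(_ az bz) /connectP[p pP def_b].
move: bA; rewrite {b bz}def_b.
elim: p a aA az pP => [|a' p IHp] a aA az /=; first by rewrite aA.
case/andP=> /and3P[_]; rewrite !inE => a'z eaa' pP.
by case: (boolP (a' \in A)) => a'A; [exact: IHp | exists a, a'].
Qed.

(** * Rerouting a longest cycle through outside vertices *)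

Section LongestCycle.

Variable c : seq T.
Hypotheses (Uc : ucycle e c).
Hypothesis c_max : forall c', ucycle e c' -> size c' <= size c.

(** Rotating [c] to start at [x] displays the two arcs between [x] and [y] as lists. Rotation
    preserves [next] and [prev], so what is proved on the rotated cycle transfers to [c]. *)
Lemma ucycle_split (x y : T) : x \in c -> y \in c -> x != y ->
  exists s1 s2 : seq T,
    [/\ ucycle e (x :: s1 ++ y :: s2), x :: s1 ++ y :: s2 =i c,
        size (x :: s1 ++ y :: s2) = size c,
        next (x :: s1 ++ y :: s2) =1 next c
      & prev (x :: s1 ++ y :: s2) =1 prev c].
Proof.
case/andP: Uc => Cc uc xc yc nxy; have [i s def_s] := rot_to xc.
have: y \in x :: s by rewrite -def_s mem_rot.
rewrite inE eq_sym (negPf nxy) /= => ys.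
case/splitPr: ys def_s => s1 s2 def_s; exists s1, s2.
split; rewrite -?def_s;
  [|exact: mem_rot|by rewrite -(size_rot i c) def_s|exact: next_rot|exact:
  prev_rot].
by rewrite /ucycle rot_cycle rot_uniq Cc uc.
Qed.

Lemma next_head (x : T) (s : seq T) (z : T) : next (x :: z :: s) x = z.
Proof. by rewrite /= eqxx. Qed.

Lemma next_middle (x y z : T) (s1 s2 : seq T) :
  uniq (x :: s1 ++ y :: z :: s2) -> next (x :: s1 ++ y :: z :: s2) y = z.
Proof.
move=> U; rewrite -(next_rot (size (x :: s1)) U y) -cat_cons rot_size_cat /=.
by rewrite eqxx.
Qed.

Lemma prev_head (x : T) (s : seq T) : uniq (x :: s) ->
  prev (x :: s) x = last x s.
Proof.
elim/last_ind: s => [|s y _] U; first by rewrite /= eqxx.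
rewrite last_rcons -(prev_rot (size (x :: s)) U x) -rcons_cons -cats1.
by rewrite rot_size_cat /= eqxx.
Qed.

(** [P] lists the inner vertices only, so that it can be substituted for the interior of an arc and
    compared with it in length. *)
Definition ear (x : T) (P : seq T) (y : T) : Prop :=
  [/\ P != [::], uniq P, {in P, forall z, z \notin c} & path e x (rcons P y)].

Lemma ear_rev (x y : T) (P : seq T) : ear x P y -> ear y (rev P) x.
Proof.
case=> P0 UP Pc pP; split; rewrite ?rev_uniq ?path_rev_rcons //.
- by rewrite -size_eq0 size_rev size_eq0.
- by move=> z; rewrite mem_rev; apply: Pc.
Qed.

Lemma ear_uniq (x y : T) (P s : seq T) : ear x P y ->
  uniq (x :: s) -> {subset x :: s <= c} -> uniq (x :: P ++ s).
Proof.
case=> _ UP Pc _ U sc.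
rewrite -[x :: P ++ s]/([:: x] ++ P ++ s) uniq_catCA cat_uniq UP.
rewrite -[[:: x] ++ s]/(x :: s) U andbT.
by apply/hasPn=> z zs; apply/negP=> /Pc; rewrite (sc z zs).
Qed.

(** Substituting [P] for the arc [s1] yields a cycle, which cannot be longer than [c]. *)
Lemma ear_short (x y : T) (s1 s2 P : seq T) :
    ucycle e (x :: s1 ++ y :: s2) -> x :: s1 ++ y :: s2 =i c ->
    size (x :: s1 ++ y :: s2) = size c -> ear x P y ->
  size P <= size s1.
Proof.
case/andP=> C U memc sizec earP; have [_ _ _ pP] := earP.
have /c_max : ucycle e (x :: P ++ y :: s2).
  apply/andP; split.
    move: C; rewrite /= !rcons_cat !cat_path /= => /and3P[_ _ ->].
    by move: pP; rewrite -cats1 cat_path /= andbT => /andP[-> ->].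
  apply: (ear_uniq earP) => [|z zs].
    by apply: subseq_uniq U;
      rewrite -cat1s -[X in subseq _ X]cat1s cat_subseq ?suffix_subseq.
  by rewrite -memc !inE mem_cat; move: zs; rewrite inE => /predU1P[->|->];
    rewrite ?eqxx ?orbT.
by rewrite -sizec /= !size_cat /= ltnS leq_add2r.
Qed.

(** This is [ear_short] for the other arc: rotate the cycle to start at [y] and reverse the ear. *)
Lemma ear_short_right (x y : T) (s1 s2 P : seq T) :
    ucycle e (x :: s1 ++ y :: s2) -> x :: s1 ++ y :: s2 =i c ->
    size (x :: s1 ++ y :: s2) = size c -> ear x P y ->
  size P <= size s2.
Proof.
have rotE : y :: s2 ++ x :: s1 = rot (size (x :: s1)) (x :: s1 ++ y :: s2).
  by rewrite -cat_cons rot_size_cat.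
move=> C memc sizec earP; rewrite -(size_rev P).
apply: (ear_short (s2 := s1) _ _ _ (ear_rev earP)); rewrite rotE.
- by case/andP: C => C U; rewrite /ucycle rot_cycle rot_uniq C.
- by move=> z; rewrite mem_rot.
by rewrite size_rot.
Qed.

(** From [x] go through [P] to [y], back along the arc to [t], over the chord to [b], and along [r]
    to [x]. This cycle trades [q] for [P]. *)
Lemma ear_cross (x y t b : T) (q s r P : seq T) :
    ucycle e (x :: (q ++ t :: s) ++ y :: b :: r) ->
    x :: (q ++ t :: s) ++ y :: b :: r =i c ->
    size (x :: (q ++ t :: s) ++ y :: b :: r) = size c ->
    ear x P y -> e t b ->
  size P <= size q.
Proof.
case/andP=> C U memc sizec earP etb; have [_ _ _ pP] := earP.
have perm_tsy : perm_eq (y :: rev (t :: s) ++ b :: r) ((t :: s) ++ y :: b :: r).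
  apply: perm_trans (_ : perm_eq (y :: (t :: s) ++ b :: r) _).
    by rewrite perm_cons perm_cat2r perm_rev.
  by rewrite -cat1s -[y :: b :: r]cat1s perm_catCA.
have Us : uniq (x :: y :: rev (t :: s) ++ b :: r).
  rewrite cons_uniq (perm_mem perm_tsy) (perm_uniq perm_tsy).
  move: U; rewrite -catA cons_uniq => /andP[].
  by rewrite cat_uniq mem_cat => /norP[_ ->] /and3P[_ _ ->].
have /c_max : ucycle e (x :: P ++ y :: rev (t :: s) ++ b :: r).
  apply/andP; split.
    move: C pP; rewrite /cycle -catA rev_cons -cats1 !rcons_cat.
    rewrite !cat_path /= !rcons_cat /= !cat_path /= last_rcons etb.
    rewrite path_rev_rcons -cats1 !cat_path /=.
    case/andP=> /and5P[_ /andP[_ pt] lt_y _ pb] lbx /and3P[-> -> _].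
    by rewrite !rcons_path pt lt_y pb; move: lbx;
      rewrite last_cat /= last_cat andbT => ->.
  apply: (ear_uniq earP) => // z; rewrite -memc inE => /predU1P[->|].
    by rewrite inE eqxx.
  by rewrite (perm_mem perm_tsy) => zs; rewrite -catA inE mem_cat zs !orbT.
rewrite -sizec -catA /= !size_cat (perm_size perm_tsy).
by rewrite ltnS leq_add2r.
Qed.

(** Both arcs have inner vertices because [P] does. A chord between the successors would allow
    [ear_cross] with [q] empty, forcing [P] to be empty. *)
Lemma ear_next (x y : T) (P : seq T) :
    x \in c -> y \in c -> x != y -> ear x P y ->
  next c x != y /\ ~~ e (next c x) (next c y).
Proof.
move=> xc yc nxy earP;
  have [s1 [s2 [C memc sizec nextc _]]] := ucycle_split xc yc nxy.
have [/andP[_ U] [P0 _ _ _]] := (C, earP).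
have := ear_short C memc sizec earP.
have := ear_short_right C memc sizec earP.
case: P {earP} P0 (earP) => // z P _ earP.
case: s2 => [|b r] // in C U memc sizec nextc * => _.
case: s1 => [|t s] // in C U memc sizec nextc * => _.
have <- : t = next c x by rewrite -nextc next_head.
have <- : b = next c y by rewrite -nextc next_middle.
split; last by apply/negP=> /(ear_cross (q := [::]) C memc sizec earP).
by apply: contraTneq U => ->; rewrite /= !mem_cat !inE eqxx !orbT andbF.
Qed.

(** Both arcs now have at least two inner vertices, so the second successor of [x] comes before [y].
    A chord from it to the successor of [y] would allow [ear_cross] with [q] reduced to [next c x]:
    one vertex lost, at least two gained. *)
Lemma long_ear_next (x y : T) (P : seq T) (a := next c x) :
    x \in c -> y \in c -> x != y -> ear x P y -> 1 < size P ->
  [/\ next c a != x, next c a != y & ~~ e (next c a) (next c y)].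
Proof.
move=> xc yc nxy earP P2;
  have [s1 [s2 [C memc sizec nextc _]]] := ucycle_split xc yc nxy.
have [/andP[_ U] /(ear_next xc yc nxy)[_ _]] := (C, earP).
have := leq_trans P2 (ear_short C memc sizec earP).
have := leq_trans P2 (ear_short_right C memc sizec earP).
case: s2 => [|b r] // in C U memc sizec nextc * => _.
case: s1 => [|t [|t' s]] // in C U memc sizec nextc * => _.
have def_a : t = a by rewrite /a -nextc next_head.
have <- : t' = next c a.
  by rewrite -def_a -nextc (next_middle (s1 := [::]) (s2 := s ++ y :: b :: r)).
have <- : b = next c y by rewrite -nextc next_middle.
split; last first.
- apply/negP=> /(ear_cross (q := [:: t]) C memc sizec earP).
  by rewrite leqNgt P2.
- apply: contraTneq U => ->; rewrite /= !mem_cat !inE eqxx orbT.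
  by rewrite !andbF.
by apply: contraTneq U => ->; rewrite /= !inE eqxx orbT.
Qed.

Let outer : rel T := induced_rel e [set z | z \notin c].

(** Removing repetitions from the outer walk keeps its ends, so distinct ends give an ear with at
    least two vertices. *)
Lemma ear_exists (u w x y : T) : u \notin c -> connect outer u w ->
  e x u -> e w y -> exists2 P, ear x P y & u != w -> 1 < size P.
Proof.
move=> uc /connectP[p0 p0P ->] exu; case/shortenP: p0P => p pP Up _ ewy.
have pc : {in u :: p, forall z, z \notin c}.
  elim: p u uc pP {exu Up ewy} => [|v p IHp] u uc /=.
    by move=> _ z; rewrite inE => /eqP->.
  case/andP=> /and3P[_ vc _] /IHp IH z; rewrite inE => /predU1P[-> //|].
  by apply: IH; rewrite inE in vc.
exists (u :: p); last by case: (p) => //=; rewrite eqxx.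
split=> //=; rewrite exu rcons_path ewy andbT.
by apply: sub_path pP => z t /and3P[].
Qed.

Lemma next_inj : injective (next c).
Proof. by case/andP: Uc => _ U; apply: can_inj (prev_next U). Qed.

Lemma nextE x : x \in c -> e x (next c x).
Proof. by case/andP: Uc => C _; apply: next_cycle. Qed.

Lemma outer_notin v u : v \notin c -> connect outer v u -> u \notin c.
Proof.
move=> vc /connectP[p pP ->]; elim: p v vc pP => //= w p IHp v vc.
by case/andP=> /and3P[_]; rewrite inE => wc _; apply: IHp.
Qed.

Lemma outer_trans v u w :
  v \notin c -> connect outer v u -> w \notin c -> e u w -> connect outer v w.
Proof.
move=> vc vu wc euw; apply: (connect_trans vu (connect1 _)).
by rewrite /outer /induced_rel /= !inE (outer_notin vc vu) wc.
Qed.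

Lemma outer_sym : connect_sym outer.
Proof. by apply: sym_connect_sym => u w;
  rewrite /outer /induced_rel /= e_sym andbCA. Qed.

(** * Attachments of a component outside the cycle *)

Section Component.

Variable v : T.
Hypothesis vc : v \notin c.

Definition attached (x : T) : bool :=
  (x \in c) && [exists u, connect outer v u && e x u].

Lemma attachedP x :
  reflect (x \in c /\ exists2 u, connect outer v u & e x u) (attached x).
Proof.
apply: (iffP andP) => [[xc /existsP[u /andP[vu exu]]]|[xc [u vu exu]]].
  by split=> //; exists u.
by split=> //; apply/existsP; exists u; rewrite vu.
Qed.

Lemma attached_ear x y u w : connect outer v u -> connect outer v w ->
  e x u -> e y w -> exists2 P, ear x P y & u != w -> 1 < size P.
Proof.
move=> vu vw exu eyw; have := outer_notin vc vu; move/ear_exists; apply=> //.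
  by apply: connect_trans vw; rewrite outer_sym.
by rewrite e_sym.
Qed.

Lemma attached_next x y : attached x -> attached y -> x != y ->
  next c x != y /\ ~~ e (next c x) (next c y).
Proof.
case/attachedP=> xc [u vu exu] /attachedP[yc [w vw eyw]] nxy.
have [P earP _] := attached_ear vu vw exu eyw.
exact: ear_next earP.
Qed.

(** For [y] equal to [next c x], the first conclusion of [attached_next] would be
    [next c x != next c x]. *)
Lemma attached_nextF x : attached x -> ~~ attached (next c x).
Proof.
move=> xX; apply/negP=> /(attached_next xX).
have /attachedP[/nextE exn _] := xX; rewrite eqxx.
by case=> //; apply: contraTneq exn => <-; rewrite e_irr.
Qed.

Lemma nonattached x u :
  x \in c -> ~~ attached x -> connect outer v u -> e u x = false.
Proof.
move=> xc nX vu; apply/negbTE; apply: contra nX; rewrite e_sym => exu.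
by apply/attachedP; split=> //; exists u.
Qed.

(** The component [K] of [v] is left by an edge avoiding [v], which gives [u'] and [y], and by an
    edge avoiding [y], which gives [u] and [x]. Only the case [u = u'] remains. *)
Lemma attached_pair w : e v w -> w \notin c -> 1 < size c ->
  exists x y u u', [/\ x \in c, y \in c & x != y] /\
    [/\ connect outer v u, connect outer v u', u != u', e x u & e y u'].
Proof.
move=> evw wc c2; pose K := [set u | connect outer v u].
have vK : v \in K by rewrite inE connect0.
have wK : w \in K by rewrite inE (outer_trans vc (connect0 _ _) wc).
have nvw : v != w by apply: contraTneq evw => ->; rewrite e_irr.
have cK x : x \in c -> x \notin K.
  by move=> xc; apply: contraL xc; rewrite inE; apply: outer_notin.
have leaveK u x : u \in K -> x \notin K -> e u x -> x \in c.
  by rewrite !inE => uK xK eux; apply: contraR xK => xc; apply: outer_trans eux.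
have other y : y \in c -> exists2 b, b \in c & b != y.
  move=> yc; exists (next c y); first by rewrite mem_next.
  by apply: contraTneq (nextE yc) => ->; rewrite e_irr.
have [b bc] : exists b, b \in c by case: (c) c2 => // b ?; exists b;
  rewrite inE eqxx.
have bv : b != v by apply: contraNneq vc => <-.
have [|u' [y [u'K yK u'v yv eu'y]]] := two_connected_boundary wK _ (cK b bc) bv.
  by rewrite eq_sym.
have yc := leaveK _ _ u'K yK eu'y; have [b' b'c b'y] := other y yc.
have vy : v != y by rewrite eq_sym.
have [u [x [uK xK uy xy eux]]] := two_connected_boundary vK vy (cK b' b'c) b'y.
have xc := leaveK _ _ uK xK eux.
have [eq_u|nuu'] := eqVneq u u'; last first.
  exists x, y, u, u'; split; split; rewrite // 1?e_sym //.
    by rewrite inE in uK.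
  by rewrite inE in u'K.
rewrite -{u' u'K eu'y u'v}eq_u in u'K eu'y u'v.
have vu : v != u by rewrite eq_sym.
have yu : y != u by rewrite eq_sym.
(* The two edges share their end [u], which is not [v]. Deleting [u] yields a third edge leaving
   [K]; its end [z] on [c] differs from [x] or from [y], so it pairs with one of the first two. *)
have [u'' [z [u''K zK u''u zu eu''z]]] := two_connected_boundary vK vu yK yu.
have zc := leaveK _ _ u''K zK eu''z; rewrite !inE in uK u''K.
have [zx|nzx] := eqVneq z x.
  by exists y, x, u, u''; split; split;
    rewrite // 1?e_sym // -?zx // eq_sym // zx.
by exists x, z, u, u''; split; split; rewrite // 1?e_sym // eq_sym.
Qed.

Lemma outer_independent w : 1 < size c -> w \notin c -> ~~ e v w.
Proof.
move=> c2 wc; apply/negP=> evw.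
have [x [y [u [u' [[xc yc nxy] [vu vu' nuu' exu eyu']]]]]] := attached_pair evw
  wc c2.
have [P earP /(_ nuu') P2] := attached_ear vu vu' exu eyu'.
have [] := long_ear_next xc yc nxy earP P2.
set a := next c x; set b := next c y; set a2 := next c a => a2x a2y a2b.
have vw : connect outer v w by apply: outer_trans evw => //; apply: connect0.
have xX : attached x by apply/attachedP; split=> //; exists u.
have yX : attached y by apply/attachedP; split=> //; exists u'.
have aX := attached_nextF xX; have bX := attached_nextF yX.
have [_ ab] := attached_next xX yX nxy.
have [ac bc a2c] : [/\ a \in c, b \in c & a2 \in c] by rewrite !mem_next.
have nvw : v != w by apply: contraTneq evw => ->; rewrite e_irr.
have nab : a != b by rewrite (inj_eq next_inj).
have vF z : z \in c -> v != z by apply: contraTneq => <-.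
have wF z : z \in c -> w != z by apply: contraTneq => <-.
(* The only edge among [v], [w], [a], [b] is [v w]. An unattached [z] sees neither [v] nor [w], so
   three edges require it to see both [a] and [b]. *)
have key z : z \in c -> ~~ attached z -> z != a -> z != b ->
    1 < e a z + e b z.
  move=> zc zX za zb.
  have := @st_graph_edge_count [:: v; w; a; b; z].
  rewrite /= !inE !negb_or nvw !vF // !wF // nab eq_sym za eq_sym zb =>
    /(_ isT erefl).
  rewrite evw !(nonattached _ _ (connect0 _ _)) // !(nonattached _ _ vw) //.
  rewrite (negPf ab); by case: (e a z); case: (e b z).
(* If [a2] is attached, [key] is applied to its successor, which is unattached and, by
   [attached_next], adjacent to neither [a] nor [b]. *)
have [a2X|a2X] := boolP (attached a2).
  have [|_ /negPf a_n] := attached_next xX a2X; first by rewrite eq_sym.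
  have [|_ /negPf b_n] := attached_next yX a2X; first by rewrite eq_sym.
  have := key (next c a2); rewrite mem_next a2c attached_nextF //.
  by rewrite !(inj_eq next_inj) a2y a2x a_n b_n => /(_ isT isT isT isT).
(* If [a2] is unattached, [key] makes it adjacent to [b], against [a2b]. *)
have a2a : a2 != a by apply: contraTneq (nextE ac) => eq_a;
  rewrite -/a2 eq_a e_irr.
have nb : a2 != b by rewrite (inj_eq next_inj); apply: contraNneq aX => eq_y;
  rewrite -/a eq_y.
by have := key a2 a2c a2X a2a nb; rewrite (e_sym b) (negPf a2b); case: (e a a2).
Qed.

End Component.

(** * Successors of the neighbours of an outside vertex *)

Lemma neighbours_next v x y : v \notin c -> x \in c -> y \in c ->
  e v x -> e v y -> x != y -> next c x != y /\ ~~ e (next c x) (next c y).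
Proof.
move=> vc xc yc evx evy nxy; apply: (@ear_next _ _ [:: v]) => //.
by split; rewrite //= ?andbT 1?e_sym ?evx // => z; rewrite inE => /eqP->.
Qed.

Lemma neighbour_nextF v x : v \notin c -> x \in c -> e v x -> ~~ e v (next c x).
Proof.
move=> vc xc evx; apply/negP=> evn.
have [||] := neighbours_next vc xc _ evx evn; rewrite ?mem_next ?eqxx //.
by apply: contraTneq (nextE xc) => <-; rewrite e_irr.
Qed.

(** [v] and the three successors are independent, so all the edges, at least three, that they span
    together with [p] meet [p]. *)
Lemma neighbours_next_dominate v x y z p : v \notin c ->
    {in [:: x; y; z], forall t, t \in c /\ e v t} -> uniq [:: x; y; z] ->
    p \notin v :: map (next c) [:: x; y; z] ->
  2 < e p v + (e p (next c x) + (e p (next c y) + e p (next c z))).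
Proof.
move=> vc; rewrite /= !inE !negb_or.
move=> vxyz /and3P[/andP[nxy nxz] nyz _] /and4P[pv px py pz].
have [[xc evx] [yc evy] [zc evz]] : [/\ x \in c /\ e v x, y \in c /\ e v y & z
  \in c /\ e v z].
  by split; apply: vxyz; rewrite !inE eqxx ?orbT.
have vn t : t \in c -> v != next c t.
  by move=> tc; apply: contraNneq vc => ->; rewrite mem_next.
have := @st_graph_edge_count [:: p; v; next c x; next c y; next c z].
rewrite /= !inE !negb_or !(inj_eq next_inj) pv px py pz !vn // nxy nxz nyz =>
  /(_ isT erefl).
have [_ /negPf->] := neighbours_next vc xc yc evx evy nxy.
have [_ /negPf->] := neighbours_next vc xc zc evx evz nxz.
have [_ /negPf->] := neighbours_next vc yc zc evy evz nyz.
by rewrite !(negPf (neighbour_nextF vc _ _)) // !addn0.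
Qed.

(* If [x] can be bypassed on [c], then [v] and [x] can be reinserted together
   between [y] and [next c y]. *)
Lemma no_reinsertion v x y : v \notin c -> x \in c -> y \in c ->
    e v x -> e v y -> x != y -> next c x != y -> next c y != x ->
    e (next c x) (prev c x) ->
  ~~ e x (next c y).
Proof.
move=> vc xc yc evx evy nxy nnx nny enp; apply/negP=> exn.
have [s1 [s2 [/andP[C U] memc sizec nextc prevc]]] := ucycle_split xc yc nxy.
move: nnx nny enp exn; rewrite -!nextc -prevc (prev_head U).
case: s1 => [|a s] in C U memc sizec {nextc prevc} *;
  first by rewrite next_head eqxx.
case: s2 => [|b r] in C U memc sizec *.
  have -> : next (x :: (a :: s) ++ [:: y]) y = x; last by rewrite eqxx.
  by rewrite -(next_rot (size (x :: a :: s)) U y) -cat_cons rot_size_cat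
    next_head.
rewrite next_head next_middle // last_cat /= => _ _ eal exb.
(* Go from [a] to [y], then through [v] and [x] to [b], along [r], and back to [a] by the edge
   bypassing [x]. This cycle has one vertex more than [c]. *)
have /c_max : ucycle e (a :: s ++ [:: y, v, x, b & r]).
  apply/andP; split.
    move: C; rewrite /= !rcons_cat !cat_path /= !rcons_path.
    case/and5P=> _ -> -> _ /andP[-> _].
    by rewrite e_sym evy evx exb e_sym eal.
  have -> : a :: s ++ [:: y, v, x, b & r] = ((a :: s) ++ [:: y]) ++ [:: v;
    x] ++ b :: r.
    by rewrite /= -catA.
  have Uv : uniq (v :: x :: (a :: s) ++ y :: b :: r) by rewrite cons_uniq memc
    vc.
  by rewrite uniq_catCA -catA.
by rewrite -sizec /= !size_cat /= !addnS ltnn.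
Qed.

End LongestCycle.

(** * An outside vertex with three neighbours on the cycle *)

Section LongestCycleDegree.

Variable c : seq T.
Hypotheses (Uc : ucycle e c).
Hypothesis c_max : forall c', ucycle e c' -> size c' <= size c.

(** Reversal exchanges [next] and [prev], so facts about successors also hold for predecessors. *)
Lemma rev_ucycle : ucycle e (rev c).
Proof.
case/andP: Uc => C U; apply/andP; split; last by rewrite rev_uniq.
rewrite rev_cycle; move: C; congr is_true.
by case: (c) => //= x s; apply: eq_path => u w; rewrite e_sym.
Qed.

(** Otherwise domination on the reversed cycle, applied to [next c x], which does not see [v], makes
    it adjacent to all three predecessors. In particular [x] can be bypassed, so by [no_reinsertion]
    it misses the successors of [y] and [z]; then [x] itself violates domination on [c]. *)
Lemma no_long_gap v x y z : v \notin c ->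
    {in [:: x; y; z], forall t, t \in c /\ e v t} -> uniq [:: x; y; z] ->
  next c x \in map (prev c) [:: x; y; z].
Proof.
move=> vc vxyz Uxyz; apply/negPn/negP=> nx.
have [[xc evx] [yc evy] [zc evz]] : [/\ x \in c /\ e v x, y \in c /\ e v y & z
  \in c /\ e v z].
  by split; apply: vxyz; rewrite !inE eqxx ?orbT.
have [nxy nxz nyz] : [/\ x != y, x != z & y != z].
  by move: Uxyz; rewrite /= !inE negb_or => /and3P[/andP[]].
have nvx : next c x \notin v :: map (next (rev c)) [:: x; y; z].
  rewrite (eq_map (next_rev _)); last by case/andP: Uc.
  by rewrite inE negb_or nx andbT; apply: contraNneq vc => <-; rewrite mem_next.
have rmax c' : ucycle e c' -> size c' <= size (rev c) by rewrite size_rev;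
  apply: c_max.
have rvc : v \notin rev c by rewrite mem_rev.
have rvxyz : {in [:: x; y; z], forall t, t \in rev c /\ e v t}.
  by move=> t /vxyz; rewrite mem_rev.
have := neighbours_next_dominate rev_ucycle rmax rvc rvxyz Uxyz nvx.
rewrite next_rev; last by case/andP: Uc.
rewrite e_sym (negPf (neighbour_nextF Uc c_max vc xc evx)) => enx.
have {}enx : e (next c x) (prev c x) by move: enx; do 3 case: (e _ _).
have [ny _] := neighbours_next Uc c_max vc xc yc evx evy nxy.
have [nz _] := neighbours_next Uc c_max vc xc zc evx evz nxz.
have [|yx _] := neighbours_next Uc c_max vc yc xc evy evx;
  first by rewrite eq_sym.
have [|zx _] := neighbours_next Uc c_max vc zc xc evz evx;
  first by rewrite eq_sym.
have exy := no_reinsertion Uc c_max vc xc yc evx evy nxy ny yx enx.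
have exz := no_reinsertion Uc c_max vc xc zc evx evz nxz nz zx enx.
have xI : x \notin v :: map (next c) [:: x; y; z].
  rewrite !inE !negb_or (contraNneq _ vc) => [|<-] //.
  rewrite (eq_sym x (next c y)) yx (eq_sym x (next c z)) zx !andbT /=.
  by apply: contraTneq (nextE Uc xc) => <-; rewrite e_irr.
have := neighbours_next_dominate Uc c_max vc vxyz Uxyz xI.
by rewrite (negPf exy) (negPf exz); do 2 case: (e _ _).
Qed.

Lemma longest_cycle_spans : 8 < #|T| -> (forall x, 2 < degree e x) ->
  1 < size c -> forall v, v \in c.
Proof.
move=> T9 deg3 c2 v; apply/negPn/negP=> vc.
have [x [y [z [[]]]]] := card_gt2P (deg3 v).
rewrite !inE => evx evy evz [nxy nyz nzx].
have outer w t : w \notin c -> e w t -> t \in c.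
  by move=> wc; apply: contraTT; apply: outer_independent.
have vxyz : {in [:: x; y; z], forall t, t \in c /\ e v t}.
  by move=> t; rewrite !inE => /or3P[] /eqP->; split=> //; apply: outer vc _.
have Uxyz : uniq [:: x; y; z] by rewrite /= !inE negb_or nxy nyz eq_sym nzx.
(* Outside vertices are not adjacent, so the three edges that [w] must send to [v] and the
   successors all go to the successors. *)
have Ic w : w \notin c -> w != v -> {in [:: x; y; z], forall t, e w (next c t)}.
  move=> wc wv; have wI : w \notin v :: map (next c) [:: x; y; z].
    rewrite inE negb_or wv; apply: contra wc => /mapP[t /vxyz[tc _] ->].
    by rewrite mem_next.
  have := neighbours_next_dominate Uc c_max vc vxyz Uxyz wI.
  rewrite (negPf (outer_independent Uc c_max wc c2 vc)).
  have e0 (b1 b2 b3 : bool) : 2 < false + (b1 + (b2 + b3)) -> [/\ b1, b2 & b3].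
    by case: b1; case: b2; case: b3.
  by case/e0=> ewx ewy ewz t; rewrite !inE => /or3P[]/eqP->.
(* Now [w] plays the role of [v]: the successors are its neighbours, so the second successors are
   pairwise non-adjacent. *)
have n_nonadj t t' w : w \notin c -> w != v -> t \in [:: x; y; z] ->
    t' \in [:: x; y; z] -> t != t' ->
  e (next c (next c t)) (next c (next c t')) = false.
  move=> wc wv t3 t'3 ntt'; apply/negbTE.
  have [|||_ /negPf->//] := neighbours_next Uc c_max wc _ _ (Ic w wc wv t t3)
    (Ic w wc wv t' t'3) _.
  - by rewrite mem_next; case: (vxyz t t3).
  - by rewrite mem_next; case: (vxyz t' t'3).
  by rewrite (inj_eq (next_inj Uc)).
(* Two such vertices together with the three second successors would be five independent
   vertices. *)
have pairF w w' : w \notin c -> w != v -> w' \notin c -> w' != v -> w = w'.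
  move=> wc wv w'c w'v; apply/eqP/negPn/negP=> nww'.
  have sub t : t \in [:: x; y; z] -> next c (next c t) \in c.
    by case/vxyz=> tc _; rewrite !mem_next.
  have nF u t : u \notin c -> u != v -> t \in [:: x; y; z] ->
      (u == next c (next c t) = false) * (e u (next c (next c t)) = false).
    move=> uc uv t3; split.
      by apply: contraNF uc => /eqP->; apply: sub.
    apply/negbTE; apply: neighbour_nextF => //; last exact: Ic.
    by rewrite mem_next; case: (vxyz t t3).
  have x3 : x \in [:: x; y; z] by rewrite inE eqxx.
  have y3 : y \in [:: x; y; z] by rewrite !inE eqxx orbT.
  have z3 : z \in [:: x; y; z] by rewrite !inE eqxx !orbT.
  have := @st_graph_edge_count [:: w; w'; next c (next c x);
    next c (next c y); next c (next c z)].
  rewrite /= !inE !negb_or !(inj_eq (next_inj Uc)) nww' nxy nyz (eq_sym x z)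
    nzx.
rewrite !(n_nonadj _ _ w) ?(eq_sym x z) //.
  by rewrite !nF // (negPf (outer_independent Uc c_max wc c2 w'c)) =>
    /(_ isT erefl).
(* At most two vertices lie off [c]: [v] and one other. The order is at least 9. *)
have c7 : 6 < size c.
  have : #|[predC c]| <= 2.
    rewrite (cardD1 v) inE vc; apply/card_le1P=> w;
      rewrite !inE => /andP[wv wc] w'.
    rewrite !inE; apply/andP/eqP=> [[w'v w'c]|->] //.
    by apply: pairF.
  move=> le2; have /andP[_ /card_uniqP size_c] := Uc.
  rewrite -(leq_add2r 2) -size_c; apply: leq_trans T9 _.
  by rewrite -(cardC (mem c)) leq_add2l.
have gap : {in [:: x; y; z], forall t, next c (next c t) \in [:: x; y; z]}.
  (* [no_long_gap] concerns the first of the three neighbours; rotating the list brings each of them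
     to the front. *)
  have gap1 k t s : rot k [:: x; y;
    z] = t :: s -> next c (next c t) \in [:: x; y; z].
    case: s => [|s1 [|s2 [|? ?]]] def; try by have := congr1 size def;
      rewrite size_rot.
    have U3 : uniq [:: t; s1; s2] by rewrite -def rot_uniq.
    have v3 : {in [:: t; s1; s2], forall u, u \in c /\ e v u}.
      by move=> u; rewrite -def mem_rot; apply: vxyz.
    have /mapP[u] := no_long_gap vc v3 U3; rewrite -def mem_rot => u3 ->.
    by rewrite next_prev //; case/andP: Uc.
  move=> t; rewrite in_cons mem_seq2 => /or3P[]/eqP->.
  - exact: (gap1 0).
  - exact: (gap1 1).
  - exact: (gap1 2).
(* By [gap] these six entries are closed under [next c], hence contain the whole cycle, which has at
   least seven vertices. *)
pose S := [:: x; y; z] ++ map (next c) [:: x; y; z].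
have Sn t : t \in S -> next c t \in S.
  rewrite !mem_cat => /orP[t3|]; first by rewrite map_f ?orbT.
  by case/mapP=> t' t'3 ->; rewrite gap.
have cS : {subset c <= S}.
  move=> t tc; have [_ xc] : x \in c /\ x \in c by case: (vxyz x);
    rewrite ?inE ?eqxx.
  have /andP[_ U] := Uc;
    have : fconnect (next c) x t by rewrite (fconnect_cycle (cycle_next U)).
  move/iter_findex => <-; elim: (findex _ _ _) => [|n IHn] /=; last exact: Sn.
  by rewrite inE eqxx.
by have /andP[_ U] := Uc; have := uniq_leq_size U cS; rewrite leqNgt c7.
Qed.

End LongestCycleDegree.

Lemma hamiltonian : 8 < #|T| -> (forall x, 2 < degree e x) ->
  exists2 c, ucycle e c & size c = #|T|.
Proof.
move=> T9 deg3; pose P k := [exists t : k.-tuple T, cycle e t && uniq t].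
have [x _] : exists x : T, x \in T by apply/card_gt0P; apply: leq_trans T9.
(* An edge counts as a [ucycle] of size 2. It starts the search for a maximum and supplies the bound
   [1 < size c] required of a longest cycle. *)
have P2 : P 2.
  have [y [_ [_ [[exy _ _] _]]]] := card_gt2P (deg3 x).
  apply/existsP; exists [tuple x; y]; move: exy; rewrite inE /= => exy.
  rewrite /= exy e_sym exy mem_seq1 !andbT.
  by apply: contraTneq exy => ->; rewrite e_irr.
have Pmax k : P k -> k <= #|T|.
  by case/existsP=> t /andP[_ /card_uniqP]; rewrite size_tuple => <-;
    apply: max_card.
case: (ex_maxnP (ex_intro _ 2 P2) Pmax) => m /existsP[t Ct] m_max.
have t_max c : ucycle e c -> size c <= size t.
  by rewrite size_tuple => Cc; apply: m_max; apply/existsP; exists (in_tuple c).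
have t2 : 1 < size t by rewrite size_tuple; apply: m_max.
exists t => //; have /andP[_ /card_uniqP <-] := Ct.
by apply: eq_card => v; rewrite (longest_cycle_spans Ct t_max T9 deg3 t2 v).
Qed.

End Graph.

Theorem theorem1p4 (T : finType) (e : rel T)
  (e_sym : symmetric e) (e_irr : irreflexive e)
  (e_2conn : k_connected e 2)
  (e_53 : st_graph e 5 3)
  (order_ge9 : 9 <= #|T|)
  (mindeg_ge3 : forall x : T, 3 <= degree e x) :
  pancyclic e.
Proof.
have [c Cc size_c] := hamiltonian e_sym e_irr e_53 e_2conn order_ge9 mindeg_ge3.
exact: hamiltonian_pancyclic order_ge9 Cc size_c.
Qed.
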